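(* For every integer $k\ge 0$, every outer $k$-planar graph has separation number at most $k+2$. Moreover, for every integer $k \ge 1$, every outer min-$k$-planar graph has separation number at most $2k+1$.
   Context: A convex drawing of a finite simple graph $G$ places the vertices at distinct points of a circle and draws every edge as a straight-line segment. A convex drawing is outer $k$-planar if every edge crosses at most $k$ other edges; it is outer min-$k$-planar if for every pair of crossing edges at least one of them is crossed by at most $k$ edges in total. A graph is outer $k$-planar (resp. outer min-$k$-planar) if it admits such a drawing. A pair $(A,B)$ of vertex sets of a graph $H$ with $n$ vertices is a separation if $A\cup B=V(H)$ and there is no edge between $A\setminus B$ and $B\setminus A$; it is balanced if $|A\setminus B|\le 2n/3$ and $|B\setminus A|\le 2n/3$; its order is $|A\cap B|$. The separation number $\mathrm{sn}(G)$ is the minimum integer $s$ such that every subgraph of $G$ has a balanced separation of order at most $s$. *)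

(* Defs.v *)
From mathcomp Require Import all_boot all_order all_algebra.
From mathcomp Require Import boolp classical_sets reals.

Set Implicit Arguments.
Unset Strict Implicit.
Unset Printing Implicit Defensive.

Import Order.TTheory GRing.Theory Num.Theory.

Local Open Scope ring_scope.

(* A finite simple graph; its vertices form a subset of an ambient finite type,
   so that a graph and its subgraphs live in the same type. *)
Record graph (T : finType) := Graph {
  vertices : {set T};
  edges : {set {set T}};
  edgesP : forall e : {set T},
    e \in edges -> e \subset vertices /\ #|e| = 2%N
}.

Definition subgraph (T : finType) (H G : graph T) : Prop :=
  vertices H \subset vertices G /\ edges H \subset edges G.

Section Drawings.
Variables (R : realType) (T : finType).
Implicit Types (G : graph T) (p : T -> 'rV[R]_2) (e f : {set T}).

(* The norm of 'rV[R]_2 is the sup norm, hence the explicit sum of squares. *)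
Definition on_circle (c : 'rV[R]_2) (r : R) (x : 'rV[R]_2) : Prop :=
  \sum_(i < 2) (x 0 i - c 0 i) ^+ 2 = r ^+ 2.

(* Only the positions of the vertices of G are relevant. *)
Definition convex_drawing G p : Prop :=
  {in vertices G &, injective p} /\
  exists (c : 'rV[R]_2) (r : R),
    0 < r /\ forall v : T, v \in vertices G -> on_circle c r (p v).

Definition open_segment (a b : 'rV[R]_2) : set 'rV[R]_2 :=
  [set x | exists t : R, 0 < t < 1 /\ x = (1 - t) *: a + t *: b]%classic.

(* Open segments are used so that two edges meeting in a common endpoint do not
   cross. *)
Definition edge_curve p e : set 'rV[R]_2 :=
  [set x | exists u v : T, e = [set u; v]%SET /\ open_segment (p u) (p v) x]%classic.

Definition crosses p e f : Prop :=
  e <> f /\ exists x : 'rV[R]_2, edge_curve p e x /\ edge_curve p f x.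

Definition crossings G p e : nat :=
  #|[set f in edges G | `[< crosses p e f >]]%SET|.

Definition outer_planar (k : nat) G : Prop :=
  exists p : T -> 'rV[R]_2,
    convex_drawing G p /\
    forall e, e \in edges G -> (crossings G p e <= k)%N.

Definition outer_min_planar (k : nat) G : Prop :=
  exists p : T -> 'rV[R]_2,
    convex_drawing G p /\
    forall e f, e \in edges G -> f \in edges G -> crosses p e f ->
      (crossings G p e <= k)%N \/ (crossings G p f <= k)%N.

End Drawings.

Section Separations.
Local Open Scope nat_scope.
Variable T : finType.
Implicit Types (G H : graph T) (A B : {set T}).

Definition separation H A B : Prop :=
  A :|: B = vertices H /\
  forall x y : T, x \in A :\: B -> y \in B :\: A -> [set x; y]%SET \notin edges H.

Definition balanced H A B : Prop :=
  3 * #|A :\: B| <= 2 * #|vertices H| /\ 3 * #|B :\: A| <= 2 * #|vertices H|.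

Definition subgraphs_separable G (s : nat) : Prop :=
  forall H, subgraph H G ->
    exists A B, separation H A B /\ balanced H A B /\ #|A :&: B| <= s.

Lemma subgraphs_separable_ex G : exists s : nat, `[< subgraphs_separable G s >].
Proof.
exists #|vertices G|; apply/asboolP => H [VHG _].
exists (vertices H), (vertices H); split; last split.
- by split=> [|x y]; rewrite ?finset.setUid // finset.setDv inE.
- by rewrite /balanced finset.setDv cards0 muln0.
- by rewrite finset.setIid subset_leq_card.
Qed.

Definition separation_number G : nat := ex_minn (subgraphs_separable_ex G).

End Separations.

(* Main.v *)
Require Import Defs.
From mathcomp Require Import all_boot all_order all_algebra.
From mathcomp Require Import boolp classical_sets reals.
From mathcomp Require Import zify ring lra.

(** Number the vertices along the circle.  A chord [i j] crossed by at most [K]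
    edges gives a separator of order at most [K + 2]: its two ends and, for each
    edge crossing it, the end outside [[i, j]].  With [K = k], resp.
    [K = 2 * k - 1], such a chord can always be replaced by one of the two
    chords [i l], [l j] of a suitable triangle on it, again crossed by at most
    [K] edges; descending to the side with more vertices until at most two thirds
    of them remain gives a balanced separator.

    To find [l], take a median of the ends in [(i, j)] of the edges crossing
    [i j], and an inclusion-maximal edge [u w] inside [[i, j]] that passes over
    it.  By maximality, the edges crossing a chord from [u] or [w] to [i] or [j]
    cross [u w] or [i j], and the median property limits the latter; so [u] or
    [w] can serve as [l].  In the min-[k] case [u w] may have too many
    crossings.  If some edge crosses [i j], choose the median to be an end of
    one: either that edge has at most [k] crossings and the median is a good
    [l], or [u w] crosses it and has at most [k].  If no edge crosses [i j],
    replace [u w] by a maximal edge over an edge crossing it. *)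

Set Implicit Arguments.
Unset Strict Implicit.
Unset Printing Implicit Defensive.
Import Order.TTheory GRing.Theory Num.Theory.

(** * Counting the edges that cross a chord of linearly ordered vertices *)

Definition alternate (i j a b : nat) : bool :=
  (i < a < j) && (j < b) || (a < i) && (i < b < j).

Section ChordCounting.
Variables (n : nat) (E : {set 'I_n * 'I_n}).
Hypothesis ltE : forall a b, (a, b) \in E -> a < b.

Definition count_edges (P : nat -> nat -> bool) : nat :=
  \sum_(e in E) P e.1 e.2.

Definition cut (i j : nat) : nat := count_edges (alternate i j).

(* Edges crossing the chord [i j] whose end between [i] and [j] lies in the
   half-open interval from [s] to [t]. *)
Definition ends (i j s t : nat) : nat :=
  count_edges (fun a b => (s <= a < t) && (j < b) || (a < i) && (s <= b < t)).

Lemma count_edges_gt0 P :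
  0 < count_edges P -> exists a b : 'I_n, (a, b) \in E /\ P a b.
Proof.
rewrite lt0n sum_nat_eq0 negb_forall => /existsP[[a b]].
rewrite negb_imply /= eqb0 negbK => /andP[abE Pab].
by exists a, b.
Qed.

Lemma ends_split i j s t r :
  i < s -> s <= t <= r -> r <= j -> ends i j s t + ends i j t r = ends i j s r.
Proof.
move=> si str rj; rewrite /ends /count_edges -big_split /=.
by apply: eq_bigr => -[a b] /ltE /= ab; lia.
Qed.

Lemma ends_cut i j : ends i j i.+1 j = cut i j.
Proof. by apply: eq_bigr => -[a b] /ltE /= ab; rewrite /alternate; lia. Qed.

Lemma ends_empty i j s : ends i j s s = 0.
Proof. by apply: big1 => -[a b] _ /=; lia. Qed.

Lemma median_end i j : i.+1 < j ->
  exists l, [/\ i < l < j, 2 * ends i j i.+1 l <= cut i j,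
    2 * ends i j l.+1 j <= cut i j & 0 < cut i j -> 0 < ends i j l l.+1].
Proof.
move=> ij; have [c0|c0] := posnP (cut i j).
  exists i.+1; rewrite ends_empty c0 leqnn ij muln0; split=> //.
  have := @ends_split i j i.+1 i.+2 j; rewrite ends_cut; lia.
(* The least [l] with more than half of the ends at or before it: minimality bounds the ends before
   [l], and the jump across one half forces an end at [l] itself. *)
have ex : exists l, (i < l < j) && (cut i j < 2 * ends i j i.+1 l.+1).
  exists j.-1; rewrite (_ : j.-1.+1 = j) ?ends_cut; lia.
case: (ex_minnP ex) => l /andP[lij hl] lmin; exists l.
have ltl : 2 * ends i j i.+1 l <= cut i j.
  have [->|li] := eqVneq l i.+1; first by rewrite ends_empty.
  rewrite leqNgt; apply/negP => h.
  have := lmin l.-1; rewrite (_ : l.-1.+1 = l); lia.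
have := @ends_split i j i.+1 l.+1 j; have := @ends_split i j i.+1 l l.+1.
rewrite ends_cut; split; lia.
Qed.

(** Excluding [i j] itself ensures that, when [a < b], at least one end lies strictly between [i]
    and [j]. *)
Definition inner_edge (i j a b : nat) : bool :=
  [&& i <= a, b <= j & (a != i) || (b != j)].

Definition maximal_edge (i j u w : nat) : Prop :=
  forall a b : 'I_n, (a, b) \in E -> inner_edge i j a b -> a <= u -> w <= b ->
    a = u :> nat /\ b = w :> nat.

Lemma ex_maximal_edge i j (a b : 'I_n) :
  (a, b) \in E -> inner_edge i j a b ->
  exists u w : 'I_n, [/\ (u, w) \in E, inner_edge i j u w, u <= a, b <= w
    & maximal_edge i j u w].
Proof.
move=> abE abij; pose P (e : 'I_n * 'I_n) :=
  [&& e \in E, inner_edge i j e.1 e.2, e.1 <= a & b <= e.2].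
have P0 : P (a, b) by rewrite /P /= abE abij !leqnn.
case: (@arg_maxnP _ (a, b) P (fun e => e.2 - e.1) P0) =>
  -[u w] /and4P /= [uwE uwij ua bw] h.
exists u, w; split=> // c d cdE cdij cu wd.
have /h /= : P (c, d) by rewrite /P cdE cdij /=; lia.
by have := ltE uwE; have := ltE cdE; lia.
Qed.

(* [x] and [y] count the edges that cross [u w] and end in [(w, j]], resp. in
   [[i, u)]. *)
Lemma maximal_edge_cuts i j (u w : 'I_n) :
  (u, w) \in E -> inner_edge i j u w -> maximal_edge i j u w ->
  exists x y,
    [/\ x + y + ends i j u.+1 w <= cut u w,
        ends i j i.+1 u.+1 + ends i j u.+1 w + ends i j w j = cut i j,
        w < j -> cut i w <= x + ends i j u.+1 w + ends i j i.+1 u.+1 /\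
                 cut w j <= x + ends i j w j &
        i < u -> cut u j <= y + ends i j u.+1 w + ends i j w j /\
                 cut i u <= y + ends i j i.+1 u.+1].
Proof.
move=> uwE uwij uwmax; have uw := ltE uwE.
have outer a b : (a, b) \in E -> [|| ~~ inner_edge i j a b, u < a, b < w |
    (a == u :> nat) && (b == w :> nat)].
  move=> abE; have := uwmax a b abE; lia.
exists (count_edges (fun a b => (u < a < w) && (w < b <= j))).
exists (count_edges (fun a b => (i <= a < u) && (u < b < w))).
move: uwij; rewrite /inner_edge => uwij.
split.
(* An edge crossing [u w] has its other end in [(w, j]], in [[i, u)] or outside [[i, j]]. *)
- rewrite /ends /cut /count_edges -!big_split /=.
  by apply: leq_sum => -[a b] /ltE /= ab; rewrite /alternate; lia.
- by rewrite !ends_split ?ends_cut //; lia.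
- move=> wj; split; rewrite /ends /cut /count_edges -!big_split /=;
  apply: leq_sum => -[a b] abE /=; have := ltE abE; have := outer _ _ abE;
    rewrite /alternate /inner_edge; lia.
- move=> wj; split; rewrite /ends /cut /count_edges -!big_split /=;
  apply: leq_sum => -[a b] abE /=; have := ltE abE; have := outer _ _ abE;
    rewrite /alternate /inner_edge; lia.
Qed.

Lemma ends_mono i j s t s' t' : s' <= s -> t <= t' -> ends i j s t <= ends i j s' t'.
Proof. by move=> ss tt; apply: leq_sum => -[a b] _ /=; lia. Qed.

(** An edge that crosses [i l] or [l j] but not [i j] is an inner edge passing over [l]. *)
Lemma cut_covered i j l : i < l < j ->
  (exists u w : 'I_n, [/\ (u, w) \in E, inner_edge i j u w, u < l < w
    & maximal_edge i j u w]) \/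
  cut i l <= cut i j /\ cut l j <= cut i j.
Proof.
move=> lij; have [|no] := boolP
  [exists e in E, inner_edge i j e.1 e.2 && (e.1 < l < e.2)].
  move=> /exists_inP[[a b] abE /andP[/= abij abl]]; left.
  have [u [w [uwE uwij ua bw uwmax]]] := ex_maximal_edge abE abij.
  by exists u, w; split=> //; lia.
right; split; apply: leq_sum => -[a b] abE /=; have := ltE abE;
  move: no; rewrite negb_exists_in => /forall_inP /(_ _ abE) /=;
  rewrite /inner_edge /alternate; lia.
Qed.

Lemma split_chord k i j :
  (forall u w, (u, w) \in E -> cut u w <= k) ->
  i.+1 < j -> cut i j <= k ->
  exists l, [/\ i < l < j, cut i l <= k & cut l j <= k].
Proof.
move=> Ek ij cij; have [l [lij hl hr _]] := median_end ij.
have [|[cil clj]] := cut_covered lij; last by exists l; split=> //; lia.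
move=> [u [w [uwE uwij ulw uwmax]]].
have [x [y [hxy hm hw hu]]] := maximal_edge_cuts uwE uwij uwmax.
have cuw := Ek _ _ uwE; have uw := ltE uwE.
have pl : ends i j i.+1 u.+1 <= ends i j i.+1 l by apply: ends_mono; lia.
have pr : ends i j w j <= ends i j l.+1 j by apply: ends_mono; lia.
have p0 : u = i :> nat -> ends i j i.+1 u.+1 = 0 by move=> ->; apply: ends_empty.
have q0 : w = j :> nat -> ends i j w j = 0 by move=> ->; apply: ends_empty.
move: uwij; rewrite /inner_edge => uwij.
(* The sum bounds [cut i w]. By the median bound [ends i j w j] is at most the other two parts of
   [cut i j], so [cut w j] is at most [k] too. If the sum exceeds [k], then
   [y < ends i j i.+1 u.+1], and both bounds for [u] drop below [cut i j]. If [w = j], then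
   [ends i j w j = 0] and [u] works again. *)
have [choose_w|choose_u] := boolP
  ((w < j) && (x + ends i j u.+1 w + ends i j i.+1 u.+1 <= k)).
  by exists w; split; lia.
by exists u; split; lia.
Qed.

Lemma split_chord_min k i j : 0 < k ->
  (forall a b c d, (a, b) \in E -> (c, d) \in E -> alternate a b c d ->
    cut a b <= k \/ cut c d <= k) ->
  i.+1 < j -> cut i j <= 2 * k - 1 ->
  exists l, [/\ i < l < j, cut i l <= 2 * k - 1 & cut l j <= 2 * k - 1].
Proof.
move=> k0 Ek ij cij.
(* Under these two bounds either end of [u w] serves, provided it is strictly between [i] and
   [j]. *)
have pick_end (u w : 'I_n) :
    (u, w) \in E -> inner_edge i j u w -> maximal_edge i j u w ->
    cut u w + ends i j i.+1 u.+1 <= 2 * k - 1 ->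
    cut u w + ends i j w j <= 2 * k - 1 ->
    exists l, [/\ i < l < j, cut i l <= 2 * k - 1 & cut l j <= 2 * k - 1].
  move=> uwE uwij uwmax hl hr.
  have [x [y [hxy hm hw hu]]] := maximal_edge_cuts uwE uwij uwmax.
  have uw := ltE uwE; move: uwij; rewrite /inner_edge => uwij.
  have [wj|jw] := ltnP w j; [exists w | exists u]; split; lia.
have [l [lij hl hr hp]] := median_end ij.
have [|[cil clj]] := cut_covered lij; last by exists l; split=> //; lia.
move=> [u [w [uwE uwij ulw uwmax]]].
have uw := ltE uwE.
have sum_ends (u' w' : 'I_n) : (u', w') \in E -> inner_edge i j u' w' ->
   ends i j i.+1 u'.+1 + ends i j u'.+1 w' + ends i j w' j = cut i j.
  by move=> /ltE uw'; rewrite /inner_edge => ?; rewrite !ends_split ?ends_cut //; lia.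
have [c0|c0] := posnP (cut i j).
  have [cuw|cuw] := leqP (cut u w) (2 * k - 1).
    by have := sum_ends _ _ uwE uwij => ?; apply: (pick_end _ _ uwE uwij uwmax); lia.
  (* Here [u w] has more than [k] crossings, so every edge crossing it has at most [k]. The maximal
     edge [c d] over [a b] still crosses [u w], since distinct maximal edges are not nested. *)
  have [a [b [abE altab]]] : exists a b, (a, b) \in E /\ alternate u w a b.
    by apply: count_edges_gt0; apply: leq_ltn_trans cuw.
  have ab := ltE abE.
  have nP : ~~ alternate i j a b.
    apply/negP => abP; suff : 0 < cut i j by rewrite c0.
    by rewrite /cut /count_edges (bigD1 (a, b)) //= abP.
  have abij : inner_edge i j a b.
    by move: uwij nP altab; rewrite /inner_edge /alternate; lia.
  have [c [d [cdE cdij ca bd cdmax]]] := ex_maximal_edge abE abij.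
  have cd := ltE cdE.
  have altcd : alternate u w c d.
    have := uwmax _ _ cdE cdij; have := cdmax _ _ uwE uwij.
    by move: uwij cdij altab; rewrite /inner_edge /alternate; lia.
  have ccd : cut c d <= k by case: (Ek _ _ _ _ uwE cdE altcd); lia.
  by have := sum_ends _ _ cdE cdij => ?; apply: (pick_end _ _ cdE cdij cdmax); lia.
have [a [b [abE abl]]] := count_edges_gt0 (hp c0).
have ab := ltE abE.
have [cab|cab] := leqP (cut a b) k.
  (* As [a b] ends at [l], an edge crossing [i l] crosses [a b] or is counted by [ends i j i.+1 l],
     which is at most [k - 1], half of [2 * k - 1] rounded down. The other side is symmetric. *)
  exists l; split=> //.
    suff : cut i l <= cut a b + ends i j i.+1 l by lia.
    rewrite /cut /ends /count_edges -big_split /=; apply: leq_sum => -[c d] /ltE /= cd.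
    by rewrite /alternate; lia.
  suff : cut l j <= cut a b + ends i j l.+1 j by lia.
  rewrite /cut /ends /count_edges -big_split /=; apply: leq_sum => -[c d] /ltE /= cd.
  by rewrite /alternate; lia.
have altuw : alternate a b u w.
  by move: uwij abl; rewrite /inner_edge /alternate; lia.
have cuw : cut u w <= k by case: (Ek _ _ _ _ abE uwE altuw); lia.
have pl : ends i j i.+1 u.+1 <= ends i j i.+1 l by apply: ends_mono; lia.
have pr : ends i j w j <= ends i j l.+1 j by apply: ends_mono; lia.
by apply: (pick_end _ _ uwE uwij uwmax); lia.
Qed.

Lemma balanced_chord K :
  (forall i j, i.+1 < j -> j < n -> cut i j <= K ->
     exists l, [/\ i < l < j, cut i l <= K & cut l j <= K]) ->
  1 < n -> exists i j, [/\ i < j < n, cut i j <= K,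
    3 * (j - i.+1) <= 2 * n & 3 * (n - (j - i).+1) <= 2 * n].
Proof.
move=> split n1.
have cut0 : cut 0 n.-1 <= K.
  suff -> : cut 0 n.-1 = 0 by [].
  apply: big1 => -[a b] _ /=; have := ltn_ord a; have := ltn_ord b.
  by rewrite /alternate; lia.
suff descent d i j : j - i <= d -> i < j < n -> cut i j <= K ->
    3 * (n - (j - i).+1) <= 2 * n ->
    exists i j, [/\ i < j < n, cut i j <= K,
      3 * (j - i.+1) <= 2 * n & 3 * (n - (j - i).+1) <= 2 * n].
  by apply: (descent n 0 n.-1) => //; lia.
elim: d i j => [|d IH] i j hd ijn cij out; first lia.
have [inn|inn] := leqP (3 * (j - i.+1)) (2 * n); first by exists i, j.
have [|||l [lij cil clj]] := split i j; [lia..|].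
(* More than two thirds of the vertices lie strictly inside, so the longer part keeps over a third,
   and at most two thirds remain outside. *)
have [le|gt] := leqP (l - i) (j - l); [apply: (IH l j)|apply: (IH i l)] => //; lia.
Qed.

End ChordCounting.

(** * From points on a circle to a linear order *)

Section CirclePositions.
Local Open Scope ring_scope.
Variables (R : realType) (T : finType).
Implicit Types (G : graph T) (p : T -> 'rV[R]_2).

(** Unit vectors have inner product 1 only if they are equal, so this finds a point of the unit
    circle that is not a vertex. Pigeonhole applies to the [#|T|.+1] distinct rational points
    [(a m, b m)]. *)
Lemma free_direction (V : {set T}) (x y : T -> R) :
  (forall v, v \in V -> x v ^+ 2 + y v ^+ 2 = 1) ->
  exists a b : R, a ^+ 2 + b ^+ 2 = 1 /\
    forall v, v \in V -> a * x v + b * y v != 1.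
Proof.
move=> xy1; pose q (m : nat) : R := m%:R ^+ 2 + 1.
have q0 m : 0 < q m by rewrite /q; have := sqr_ge0 (m%:R : R); lra.
pose a m := (m%:R ^+ 2 - 1) / q m; pose b m := (2 * m%:R) / q m.
have ab1 m : a m ^+ 2 + b m ^+ 2 = 1.
  by rewrite /a /b; have := q0 m; rewrite /q => qm; field; lra.
have aE s : a s = 1 - 2 / q s by rewrite /a; have := q0 s; rewrite /q => qs; field; lra.
have inv s : 2 / (1 - (1 - 2 / q s)) = q s.
  by have := q0 s => qs; field; lra.
have [[m hm]|no] := pselect (exists m, forall v, v \in V -> a m * x v + b m * y v != 1).
  by exists (a m), (b m).
have /choice[f fP] (m : 'I_#|T|.+1) : exists v, v \in V /\ a m * x v + b m * y v = 1.
  apply: contrapT => nov; apply: no; exists m => v vV.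
  by apply/eqP => e1; apply: nov; exists v.
have fa (m : 'I_#|T|.+1) : a m = x (f m).
  have [/xy1 hv h] := fP m; have := ab1 m => h1.
  have h2 : (a m - x (f m)) ^+ 2 + (b m - y (f m)) ^+ 2 = 0.
    transitivity (a m ^+ 2 + b m ^+ 2 + (x (f m) ^+ 2 + y (f m) ^+ 2)
      - 2 * (a m * x (f m) + b m * y (f m))); first by ring.
    rewrite h1 hv h; ring.
  apply/eqP; rewrite -subr_eq0 -sqrf_eq0; apply/eqP.
  by have := sqr_ge0 (a m - x (f m)); have := sqr_ge0 (b m - y (f m)); lra.
have finj : injective f.
  move=> m m' ff; have : a m = a m' by rewrite !fa ff.
  rewrite !aE => /(congr1 (fun z => 2 / (1 - z))).
  rewrite !inv /q => /addIr /eqP; rewrite eqrXn2 ?ler0n // eqr_nat => /eqP.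
  exact: val_inj.
by have := leq_card f finj; rewrite card_ord ltnn.
Qed.

(* The parameter is the stereographic projection of the circle from a point
   that is not a vertex. *)
Lemma rational_positions G p : convex_drawing G p ->
  exists (t : T -> R) (A B C : 'I_2 -> R), forall v, v \in vertices G ->
    forall h, p v 0 h = (A h * t v ^+ 2 + B h * t v + C h) / (t v ^+ 2 + 1).
Proof.
move=> [_ [c [r [r0 circ]]]].
pose x v := (p v 0 0 - c 0 0) / r; pose y v := (p v 0 1 - c 0 1) / r.
have xy1 v : v \in vertices G -> x v ^+ 2 + y v ^+ 2 = 1.
  move=> /circ; rewrite /on_circle big_ord_recl big_ord1 /= => h.
  have -> : x v ^+ 2 + y v ^+ 2 =
    ((p v 0 0 - c 0 0) ^+ 2 + (p v 0 1 - c 0 1) ^+ 2) / r ^+ 2.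
    by rewrite /x /y; field; lra.
  rewrite (_ : lift ord0 ord0 = 1) in h; last exact: val_inj.
  by rewrite h divff // sqrf_eq0; lra.
have [a [b [ab1 free]]] := free_direction xy1.
pose t v := (a * y v - b * x v) / (1 - (a * x v + b * y v)).
(* The inverse projection [X = (t ^+ 2 - 1) / (t ^+ 2 + 1)], [Y = 2 * t / (t ^+ 2 + 1)], rotated by
   [(a, b)], scaled by [r] and centred at [c]. *)
exists t, (fun h => c 0 h + r * (if h == 0 then a else b)),
  (fun h => 2 * r * (if h == 0 then - b else a)),
  (fun h => c 0 h - r * (if h == 0 then a else b)) => v vV h.
have X1 := free v vV; have xy := xy1 v vV.
pose X := a * x v + b * y v; pose Y := a * y v - b * x v.
have XY : Y ^+ 2 = 1 - X ^+ 2.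
  apply/eqP; rewrite eq_sym subr_eq; apply/eqP.
  transitivity ((a ^+ 2 + b ^+ 2) * (x v ^+ 2 + y v ^+ 2)); last by rewrite /X /Y; ring.
  by rewrite ab1 xy mulr1.
have dX : 1 - X != 0 by rewrite subr_eq0 eq_sym.
have tE : t v = Y / (1 - X) by [].
have t1 : t v ^+ 2 + 1 = 2 / (1 - X).
  rewrite tE expr_div_n XY; field; exact: dX.
have t2 : t v ^+ 2 = (1 + X) / (1 - X).
  rewrite tE expr_div_n XY; field; exact: dX.
have xE : x v = a * X - b * Y.
  rewrite /X /Y -[LHS]mul1r -ab1; ring.
have yE : y v = b * X + a * Y.
  rewrite /X /Y -[LHS]mul1r -ab1; ring.
have pxE : p v 0 0 = c 0 0 + r * x v by rewrite /x; field; lra.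
have pyE : p v 0 1 = c 0 1 + r * y v by rewrite /y; field; lra.
rewrite t1 t2 tE.
have [->|h0] := eqVneq h 0.
  by rewrite pxE xE; field.
have -> : h = 1 by apply: val_inj; case: h h0 => -[|[|]].
by rewrite pyE yE; field.
Qed.

Lemma crosses_of_alternating G p : convex_drawing G p ->
  exists t : T -> R, {in vertices G &, injective t} /\
    forall a b c d, a \in vertices G -> b \in vertices G -> c \in vertices G ->
      d \in vertices G -> t a < t b -> t b < t c -> t c < t d ->
      crosses p [set a; c]%SET [set b; d]%SET.
Proof.
move=> drawing; have [t [A [B [C pE]]]] := rational_positions drawing.
case: drawing => pinj _; exists t; split.
  move=> u v uV vV tuv; apply: pinj => //; apply/rowP => h.
  by rewrite !pE // tuv.
move=> a b c d aV bV cV dV ab bc cd; split.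
  move=> /setP/(_ a); rewrite !inE eqxx /= => /esym /orP[] /eqP ad.
    by move: ab; rewrite ad ltxx.
  by move: (lt_trans ab (lt_trans bc cd)); rewrite ad ltxx.
(* The positions are quadratic polynomials in [t] over [t ^+ 2 + 1], and third
   divided differences of quadratic polynomials vanish. *)
pose wa := (t c - t b) * (t d - t b) * (t d - t c) * (t a ^+ 2 + 1).
pose wb := (t c - t a) * (t d - t a) * (t d - t c) * (t b ^+ 2 + 1).
pose wc := (t b - t a) * (t d - t a) * (t d - t b) * (t c ^+ 2 + 1).
pose wd := (t b - t a) * (t c - t a) * (t c - t b) * (t d ^+ 2 + 1).
have s0 v : 0 < t v ^+ 2 + 1 by have := sqr_ge0 (t v); lra.
have wa0 : 0 < wa by rewrite /wa !mulr_gt0 //; lra.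
have wb0 : 0 < wb by rewrite /wb !mulr_gt0 //; lra.
have wc0 : 0 < wc by rewrite /wc !mulr_gt0 //; lra.
have wd0 : 0 < wd by rewrite /wd !mulr_gt0 //; lra.
have W : wa + wc = wb + wd by rewrite /wa /wb /wc /wd; ring.
(* Both segments contain the weighted mean of their ends, and the two means coincide. *)
exists ((1 - wc / (wa + wc)) *: p a + (wc / (wa + wc)) *: p c); split.
  exists a, c; split=> //; exists (wc / (wa + wc)); split=> //.
  by rewrite divr_gt0 ?ltr_pdivrMr //=; lra.
exists b, d; split=> //; exists (wd / (wb + wd)); split.
  by rewrite divr_gt0 ?ltr_pdivrMr //=; lra.
apply/rowP => h; rewrite !mxE.
have -> : (1 - wc / (wa + wc)) * p a 0 h + wc / (wa + wc) * p c 0 h =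
  (wa * p a 0 h + wc * p c 0 h) / (wa + wc) by field; lra.
have -> : (1 - wd / (wb + wd)) * p b 0 h + wd / (wb + wd) * p d 0 h =
  (wb * p b 0 h + wd * p d 0 h) / (wb + wd) by field; lra.
rewrite W; congr (_ / _); rewrite /wa /wb /wc /wd !pE //.
have cancel (m q s : R) : 0 < s -> m * s * (q / s) = m * q by move=> ?; field; lra.
by rewrite !cancel //; ring.
Qed.

End CirclePositions.

(** * Separations obtained from chords *)

Lemma card_ord_leq_size n (X : {set 'I_n}) (r : seq nat) :
  (forall a, a \in X -> val a \in r) -> #|X| <= size r.
Proof.
move=> Xr; rewrite cardE -(size_map val); apply: uniq_leq_size.
  by rewrite map_inj_uniq ?enum_uniq //; apply: val_inj.
by move=> _ /mapP[a aX ->]; apply: Xr; rewrite mem_enum in aX.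
Qed.

Section Enumerations.
Variables (T : finType) (H : graph T) (s : 'I_#|vertices H| -> T).
Hypotheses (s_inj : injective s) (s_vertices : forall a, s a \in vertices H).

Local Notation position := 'I_#|vertices H|.

Definition ordered_edges : {set position * position} :=
  [set e : position * position |
    (e.1 < e.2) && ([set s e.1; s e.2]%SET \in edges H)]%SET.

Lemma ordered_edges_lt a b : (a, b) \in ordered_edges -> a < b.
Proof. by rewrite inE => /andP[]. Qed.

Lemma ordered_edges_edges a b :
  (a, b) \in ordered_edges -> [set s a; s b]%SET \in edges H.
Proof. by rewrite inE => /andP[]. Qed.

Lemma enumeration_surj : s @: [set: position] = vertices H.
Proof.
apply/eqP; rewrite eqEcard card_imset // cardsT card_ord leqnn andbT.
by apply/fintype.subsetP => _ /imsetP[a _ ->].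
Qed.

Lemma chord_separation (i j : nat) : i < j < #|vertices H| ->
  exists A B, [/\ separation H A B, #|A :\: B| <= j - i.+1,
    #|B :\: A| <= #|vertices H| - (j - i).+1 &
    #|A :&: B| <= cut ordered_edges i j + 2].
Proof.
move=> ijn.
pose X := [set e : position * position
  in ordered_edges | alternate i j e.1 e.2]%SET.
(* The ends outside [[i, j]] of the crossing edges. Once they join [P], no edge runs from the open
   interval to the rest, and [P] meets [Q] only in [S], [i] and [j]. *)
pose S : {set position} :=
  [set (if i < e.1 < j then e.2 else e.1) | e : position * position in X]%SET.
pose P : {set position} := [set a : position | (i <= a <= j) || (a \in S)]%SET.
pose Q : {set position} := [set a : position | ~~ (i < a < j)]%SET.
have inside x : x \in s @: P :\: s @: Q -> exists2 a : position, x = s a & i < a < j.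
  rewrite inE => /andP[xQ /imsetP[a _ xa]]; exists a => //.
  by apply: contraR xQ => aQ; rewrite xa imset_f // inE.
have outside x : x \in s @: Q :\: s @: P ->
    exists a : position, [/\ x = s a, (a < i) || (j < a) & a \notin S].
  rewrite inE => /andP[xP /imsetP[a _ xa]]; exists a.
  have : a \notin P by apply: contra xP => aP; rewrite xa imset_f.
  by rewrite inE negb_or => /andP[aP aS]; split=> //; lia.
exists (s @: P), (s @: Q); split.
- split.
    have PQ : P :|: Q = finset.setT by apply/setP => a; rewrite !inE; lia.
    by rewrite -imsetU PQ enumeration_surj.
  move=> x y /inside[a -> aij] /outside[b [-> bij bS]].
  apply/negP => ab; move/negP: bS; apply.
  have [lt_ba|lt_ab|/val_inj e] := ltngtP b a; last by move: aij bij; rewrite e; lia.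
  - apply/imsetP; exists (b, a) => /=; last by case: ifP => //; lia.
    by rewrite !inE /= lt_ba finset.setUC ab /alternate /=; lia.
  - apply/imsetP; exists (a, b) => /=; last by rewrite aij.
    by rewrite !inE /= lt_ab ab /alternate /=; lia.
- apply: (@leq_trans #|[set a : position | i < a < j]%SET|).
    rewrite -(card_imset _ s_inj); apply/subset_leq_card/fintype.subsetP.
    by move=> x /inside[a -> aij]; rewrite imset_f // inE.
  rewrite -(size_iota i.+1 (j - i.+1)); apply: card_ord_leq_size => a.
  by rewrite inE mem_iota /=; lia.
- apply: (@leq_trans #|[set a : position | (a < i) || (j < a)]%SET|).
    rewrite -(card_imset _ s_inj); apply/subset_leq_card/fintype.subsetP.
    by move=> x /outside[a [-> aij _]]; rewrite imset_f // inE.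
  have -> : #|vertices H| - (j - i).+1 =
    size (iota 0 i ++ iota j.+1 (#|vertices H| - j.+1)).
    by rewrite size_cat !size_iota; lia.
  apply: card_ord_leq_size => a; have := ltn_ord a.
  by rewrite inE mem_cat !mem_iota /=; lia.
- rewrite -imsetI; last by move=> ? ? _ _; apply: s_inj.
  rewrite card_imset //.
  apply: (@leq_trans #|S :|:
    [set a : position | (a == i :> nat) || (a == j :> nat)]%SET|).
    by apply/subset_leq_card/fintype.subsetP => a; rewrite !inE; case: (a \in S) => //=; lia.
  apply: leq_trans (leq_card_setU _ _) _; apply: leq_add.
    apply: leq_trans (leq_imset_card _ _) _.
    rewrite -sum1dep_card big_mkcondr /= /cut /count_edges.
    by apply: leq_sum => e _; case: ifP.
  rewrite -[2]/(size [:: i; j]); apply: card_ord_leq_size => a.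
  by rewrite !inE.
Qed.

Lemma balanced_separation K :
  (forall i j, i.+1 < j -> j < #|vertices H| -> cut ordered_edges i j <= K ->
     exists l, [/\ i < l < j, cut ordered_edges i l <= K
       & cut ordered_edges l j <= K]) ->
  exists A B, separation H A B /\ balanced H A B /\ #|A :&: B| <= K + 2.
Proof.
move=> split; have [n1|n1] := leqP #|vertices H| 1.
  (* With at most one vertex there is no chord; the trivial separation has order at most 1. *)
  exists (vertices H), (vertices H); rewrite finset.setIid /balanced finset.setDv cards0.
  split; first by split=> [|x y]; rewrite ?finset.setUid // finset.setDv inE.
  by split; lia.
have [i [j [ijn cij inn out]]] := balanced_chord split n1.
have [A [B [sep cA cB cAB]]] := chord_separation ijn.
by exists A, B; split=> //; split; [split|]; lia.
Qed.

End Enumerations.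

(** * Transfer from drawings to counts, and the two bounds *)

Section DrawingsOfSubgraphs.
Variables (R : realType) (T : finType).
Implicit Types (G H : graph T) (p : T -> 'rV[R]_2).

Lemma crosses_sym p e f : crosses p e f -> crosses p f e.
Proof. by move=> [ef [x [xe xf]]]; split=> [/esym //|]; exists x. Qed.

Lemma crossings_subgraph H G p e :
  subgraph H G -> crossings H p e <= crossings G p e.
Proof.
move=> [_ /fintype.subsetP HG]; apply/subset_leq_card/fintype.subsetP => f.
by rewrite !inE => /andP[/HG -> ->].
Qed.

Lemma convex_drawing_subgraph H G p :
  subgraph H G -> convex_drawing G p -> convex_drawing H p.
Proof.
move=> [/fintype.subsetP HG _] [pinj [c [r [r0 circ]]]]; split.
  by move=> u v /HG uG /HG vG; apply: pinj.
by exists c, r; split=> // v /HG; apply: circ.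
Qed.

(** Sorting by the stereographic parameter lists the vertices in circular order. *)
Lemma circular_enumeration H p : convex_drawing H p ->
  exists s : 'I_#|vertices H| -> T,
    [/\ injective s, forall a, s a \in vertices H &
        forall a b c d : 'I_#|vertices H|, alternate a b c d ->
          crosses p [set s a; s b]%SET [set s c; s d]%SET].
Proof.
move=> /crosses_of_alternating[t [tinj tcross]].
pose le u v := (t u <= t v)%R.
have szE : size (sort le (enum (vertices H))) == #|vertices H|.
  by rewrite size_sort cardE.
pose s := tnth (Tuple szE).
have sV a : s a \in vertices H.
  by have := mem_tnth a (Tuple szE); rewrite /= mem_sort mem_enum.
have s_inj : injective s.
  by apply/injectiveP; rewrite /injectiveb /dinjectiveb map_tnth_enum /= sort_uniq enum_uniq.
have slt (a b : 'I_#|vertices H|) : a < b -> (t (s a) < t (s b))%R.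
  move=> ab; rewrite lt_neqAle; apply/andP; split.
    by apply/eqP => /(tinj _ _ (sV a) (sV b)) /s_inj e; move: ab; rewrite e ltnn.
  rewrite /s !(tnth_nth (s a)) /=.
  have le_trans' : transitive le by move=> ? ? ?; apply: le_trans.
  have le_refl' : reflexive le by move=> ?; apply: lexx.
  apply: (sorted_leq_nth le_trans' le_refl') => //; last exact: ltnW.
  - by apply: sort_sorted => u v; apply: le_total.
  - by rewrite inE (eqP szE).
  - by rewrite inE (eqP szE).
exists s; split=> // a b c d /orP[/andP[/andP[ac cb] bd]|/andP[ca /andP[ad db]]].
  by apply: tcross; rewrite ?sV ?slt.
by apply: crosses_sym; apply: tcross; rewrite ?sV ?slt.
Qed.

Lemma cut_crossings H p (s : 'I_#|vertices H| -> T) :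
  injective s ->
  (forall a b c d : 'I_#|vertices H|, alternate a b c d ->
     crosses p [set s a; s b]%SET [set s c; s d]%SET) ->
  forall a b : 'I_#|vertices H|,
    cut (ordered_edges s) a b <= crossings H p [set s a; s b]%SET.
Proof.
move=> s_inj s_cross a b.
pose X := [set e : 'I_#|vertices H| * 'I_#|vertices H|
  in ordered_edges s | alternate a b e.1 e.2]%SET.
have -> : cut (ordered_edges s) a b = #|X|.
  rewrite -sum1dep_card big_mkcondr /=; apply: eq_bigr => e _.
  by case: alternate.
(* Increasing pairs are determined by their unordered pair of ends, so distinct pairs give distinct
   crossing edges. *)
have pair_inj : {in X &, injective
    (fun e : 'I_#|vertices H| * 'I_#|vertices H| => [set s e.1; s e.2]%SET)}.
  move=> [c d] [c' d']; rewrite !inE /= => /andP[/andP[cd _] _] /andP[/andP[cd' _] _] /setP e.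
  have := e (s c); have := e (s d); have := e (s c').
  rewrite !inE !eqxx ?orbT !(inj_eq s_inj) -!val_eqE /=.
  move=> h1 h2 h3; congr (_, _); apply: val_inj => /=; lia.
rewrite -(card_in_imset pair_inj); apply/subset_leq_card/fintype.subsetP => _ /imsetP[e eX ->].
move: eX; rewrite !inE => /andP[/andP[_ ->] alt] /=.
by apply/asboolP; apply: s_cross.
Qed.

Lemma separation_number_leq G r :
  (forall H, subgraph H G ->
     exists A B, separation H A B /\ balanced H A B /\ #|A :&: B| <= r) ->
  separation_number G <= r.
Proof.
move=> sepG; rewrite /separation_number; case: ex_minnP => m _; apply.
exact/asboolP.
Qed.

End DrawingsOfSubgraphs.

Theorem theorem16 (R : realType) :
  (forall (k : nat) (T : finType) (G : graph T),
     outer_planar R k G -> (separation_number G <= k + 2)%N) /\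
  (forall (k : nat) (T : finType) (G : graph T),
     (1 <= k)%N -> outer_min_planar R k G -> (separation_number G <= 2 * k + 1)%N).
Proof.
split=> k T G.
  move=> [p [drawing crossG]]; apply: separation_number_leq => H HG.
  have [s [s_inj sV s_cross]] :=
    circular_enumeration (convex_drawing_subgraph HG drawing).
  apply: (balanced_separation s_inj sV) => i j ij _ cij.
  apply: split_chord ij cij => [a b|u w uwE]; first exact: ordered_edges_lt.
  apply: leq_trans (cut_crossings s_inj s_cross u w) _.
  apply: leq_trans (crossings_subgraph p _ HG) _; apply: crossG.
  by case: HG => _ /fintype.subsetP; apply; apply: ordered_edges_edges.
move=> k0 [p [drawing crossG]]; apply: separation_number_leq => H HG.
have [s [s_inj sV s_cross]] :=
  circular_enumeration (convex_drawing_subgraph HG drawing).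
(* The subtraction is truncated, so this uses [1 <= k]. *)
rewrite (_ : 2 * k + 1 = 2 * k - 1 + 2); last by lia.
have edgeG (a b : 'I_#|vertices H|) : (a, b) \in ordered_edges s ->
    [set s a; s b]%SET \in edges G.
  by case: HG => _ /fintype.subsetP sub ab; apply/sub/ordered_edges_edges.
have cutG (a b : 'I_#|vertices H|) :
    cut (ordered_edges s) a b <= crossings G p [set s a; s b]%SET.
  exact: leq_trans (cut_crossings s_inj s_cross a b) (crossings_subgraph p _ HG).
apply: (balanced_separation s_inj sV) => i j ij _ cij.
apply: split_chord_min ij cij => // [a b|a b c d abE cdE alt].
  exact: ordered_edges_lt.
case: (crossG _ _ (edgeG _ _ abE) (edgeG _ _ cdE) (s_cross _ _ _ _ alt)) => h;
  [left|right]; exact: leq_trans (cutG _ _) h.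
Qed.
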